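(* Let $P$ be the transition kernel of a $\pi$-irreducible Markov chain that is reversible with respect to its invariant probability measure $\pi$ and non-negative definite. Assume that there exists an accessible atom $A$ such that $$M:=\sup_{x\in X}\mathbb{E}_x[\sigma_A]<\infty .$$ Then for all $1<\lambda<e^{1/M}$ (and all $n$), $$\|P^n-\pi\|\le D_1e^{-n/M}+E_1\lambda^{-n},$$ where $$D_1=C_1\Bigl(1-\frac{e^{1/M}-1}{e^{1/M}-\lambda}M_1\Bigr),\qquad E_1=M_1\Bigl((2-C_1)^+\lambda^{-1}+\frac{e^{1/M}-1}{e^{1/M}-\lambda}C_1\Bigr),$$ $$C_1=\bigl(\pi(A)^{-1}-1\bigr)^{1/2},\qquad M_1=\lambda(1-M\log\lambda)^{-1}.$$
   Context: $\Phi=\{\Phi_n:n\in\mathbb{Z}_+\}$ is a discrete-time homogeneous Markov chain on a general state space $X$ with countably generated $\sigma$-field $\mathscr{B}(X)$ and $n$-step transition kernel $P^n(x,B)=\mathbb{P}_x\{\Phi_n\in B\}$; $\mathbb{P}_x,\mathbb{E}_x$ are probability and expectation given $\Phi_0=x$. The chain has a (unique) invariant probability measure $\pi$ and is $\pi$-irreducible: if $\pi(B)>0$, there exists $n\in\mathbb{N}$ such that $P^n(x,B)>0$ for all $x\in X$. It is assumed that $P^n(x,\cdot)\ll\pi$ ($n\ge1$), with density $p^n(x,y)$. Reversible: $\pi(dx)P(x,dy)=\pi(dy)P(y,dx)$. Non-negative definite: $\int_X f(x)Pf(x)\,\pi(dx)\ge0$ for all $f\in L^2(\pi,X)$, where $Pf(x)=\int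 f(y)P(x,dy)$. A set $A\in\mathscr{B}(X)$ is an atom if there is a probability measure $\nu$ on $\mathscr{B}(X)$ with $P(x,B)=\nu(B)$ for all $x\in A$, $B\in\mathscr{B}(X)$; it is an accessible atom if moreover $\pi(A)>0$. $\sigma_A=\inf\{n\ge0:\Phi_n\in A\}$. $\|P^n-\pi\|=\sup_{x\in X}\|P^n(x,\cdot)-\pi\|_{\mathrm{Var}}$, where $\|\mu\|_{\mathrm{Var}}=\sup_{|f|\le1}|\mu(f)|$ for a signed measure $\mu$. $a^+=\max\{a,0\}$. *)

(* Defs.v *)
From HB Require Import structures.
From mathcomp Require Import all_boot all_order all_algebra.
From mathcomp Require Import all_classical all_reals all_analysis.
Set Implicit Arguments.
Unset Strict Implicit.
Unset Printing Implicit Defensive.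
Import Order.TTheory GRing.Theory Num.Theory.
Import numFieldNormedType.Exports.
Local Open Scope classical_set_scope.
Local Open Scope ring_scope.
Local Open Scope ereal_scope.

Definition countably_generated d (X : measurableType d) : Prop :=
  exists2 G : set (set X), countable G & (@measurable d X) = <<s G >>.

(* sigma(Phi_0, ..., Phi_n) *)
Definition natural_filtration d d' (W : measurableType d')
    (X : measurableType d) (Phi : nat -> {mfun W >-> X}) (n : nat) :
    set (set W) :=
  <<s \bigcup_(k in [set k | (k <= n)%N])
        preimage_set_system setT (Phi k) measurable >>.

(* Under each [Px x], [Phi] is a homogeneous Markov chain with transition
   kernel [P] started at [x].  Singletons need not be measurable, so
   "Phi_0 = x" says that the law of Phi_0 is the Dirac mass at [x].  The second
   clause is Px(Phi_(n+1) \in B | Phi_0, ..., Phi_n) = P (Phi_n) B a.s., with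
   conditional probability unfolded to its defining integral identity. *)
Definition markov_chain d d' (R : realType) (W : measurableType d')
    (X : measurableType d) (P : R.-pker X ~> X) (Px : X -> probability W R)
    (Phi : nat -> {mfun W >-> X}) : Prop :=
  (forall x (B : set X), measurable B -> Px x (Phi 0%N @^-1` B) = \d_x B) /\
  (forall x n (F : set W) (B : set X),
     natural_filtration Phi n F -> measurable B ->
     Px x (F `&` Phi n.+1 @^-1` B) = \int[Px x]_(w in F) P (Phi n w) B).

(* P^n(x, .) = Px(Phi_n \in .) *)
Definition nstep d d' (R : realType) (W : measurableType d')
    (X : measurableType d) (Px : X -> probability W R)
    (Phi : nat -> {mfun W >-> X}) (n : nat) (x : X) : probability X R :=
  distribution (Px x) (Phi n).

Definition invariant_prob d (R : realType) (X : measurableType d)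
    (P : R.-pker X ~> X) (pi : probability X R) : Prop :=
  forall B : set X, measurable B -> \int[pi]_x P x B = pi B.

(* Measures are functions on all sets, meaningful only on measurable ones,
   hence equality is only required there. *)
Definition unique_invariant_prob d (R : realType) (X : measurableType d)
    (P : R.-pker X ~> X) (pi : probability X R) : Prop :=
  invariant_prob P pi /\
  (forall pi' : probability X R, invariant_prob P pi' ->
     forall B : set X, measurable B -> pi' B = pi B).

Definition pi_irreducible d d' (R : realType) (W : measurableType d')
    (X : measurableType d) (Px : X -> probability W R)
    (Phi : nat -> {mfun W >-> X}) (pi : probability X R) : Prop :=
  forall B : set X, measurable B -> 0 < pi B ->
    exists2 n : nat, (0 < n)%N & forall x, 0 < nstep Px Phi n x B.

(* Equality of the measures pi(dx)P(x,dy) and pi(dy)P(y,dx) on X * X. *)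
Definition reversible d (R : realType) (X : measurableType d)
    (P : R.-pker X ~> X) (pi : probability X R) : Prop :=
  forall E : set (X * X), measurable E ->
    \int[pi]_x P x (xsection E x) = \int[pi]_y P y (ysection E y).

(* For f in L^2(pi) the inner integral Pf(x) converges for pi-almost every x,
   and f * Pf is pi-integrable, so the real-valued integrals are genuine. *)
Definition nonneg_definite d (R : realType) (X : measurableType d)
    (P : R.-pker X ~> X) (pi : probability X R) : Prop :=
  forall f : X -> R, f \in Lfun pi 2%:E ->
    (0 <= \int[pi]_x (f x * \int[P x]_y f y))%R.

Definition is_atom d (R : realType) (X : measurableType d)
    (P : R.-pker X ~> X) (A : set X) : Prop :=
  measurable A /\
  exists nu : probability X R,
    forall x (B : set X), A x -> measurable B -> P x B = nu B.

Definition accessible_atom d (R : realType) (X : measurableType d)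
    (P : R.-pker X ~> X) (pi : probability X R) (A : set X) : Prop :=
  is_atom P A /\ 0 < pi A.

(* inf {n >= 0 : Phi_n \in A}; the infimum of the empty set is +oo. *)
Definition hitting_time d d' (R : realType) (W : measurableType d')
    (X : measurableType d) (Phi : nat -> {mfun W >-> X}) (A : set X) (w : W) :
    \bar R :=
  ereal_inf [set n%:R%:E | n in [set n : nat | A (Phi n w)]].

(* The norm || mu - nu ||_Var = sup_{|f| <= 1} |mu(f) - nu(f)| *)
Definition var_dist d (R : realType) (X : measurableType d)
    (mu nu : probability X R) : \bar R :=
  ereal_sup [set `| \int[mu]_y (f y)%:E - \int[nu]_y (f y)%:E |
            | f in [set f : X -> R | measurable_fun setT f /\
                                     forall y, (`|f y| <= 1)%R]].

(* || P^n - pi || *)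
Definition nstep_dist d d' (R : realType) (W : measurableType d')
    (X : measurableType d) (Px : X -> probability W R)
    (Phi : nat -> {mfun W >-> X}) (pi : probability X R) (n : nat) : \bar R :=
  ereal_sup (range (fun x => var_dist (nstep Px Phi n x) pi)).

Section Constants.
Variables (R : realType) (M lambda piA : R).
Local Open Scope ring_scope.

Definition C1 : R := Num.sqrt (piA^-1 - 1).
Definition M1 : R := lambda * (1 - M * ln lambda)^-1.
Definition D1 : R :=
  C1 * (1 - (expR (1 / M) - 1) / (expR (1 / M) - lambda) * M1).
Definition E1 : R :=
  M1 * (Num.max (2 - C1) 0 * lambda^-1
        + (expR (1 / M) - 1) / (expR (1 / M) - lambda) * C1).
End Constants.

(* Main.v *)
(** Conditioning on the hitting time sigma of A reduces the claim to two rates.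
    - Tail of sigma: with h = E_x(sigma), the function V = 1 + c h satisfies
      P V <= V / lambda off A for a suitable c, because h <= M; hence
      P_x(sigma >= n) <= lambda^-n / (1 - M (1 - 1/lambda)).
    - Return to equilibrium from A: the kernel killed on A is self-adjoint on
      L^2(pi) and its powers decay like e^(-n/M) by the tail bound at
      lambda = e^(1/M), so its norm is at most rho = e^(-1/M).  A centered f that
      is constant on A differs by a constant from a function vanishing on A, so
      <f, P f> <= rho <f, f>; as P is non-negative definite, Cauchy-Schwarz for
      the form <f, P g> gives |P f| <= rho |f|.  Applied to the density
      1_A / pi(A) - 1, this gives |P^n(a, .) - pi| <= C1 rho^n for a in A, n > 0.
    Everything is done on bounded measurable functions, so that neither L^2(pi)
    nor the spectral theorem is needed. *)

Require Import Defs.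
From HB Require Import structures.
From mathcomp Require Import all_boot all_order all_algebra.
From mathcomp Require Import all_classical all_reals all_analysis.
From mathcomp Require Import measurable_realfun zify ring lra.
Set Implicit Arguments.
Unset Strict Implicit.
Unset Printing Implicit Defensive.
Import Order.TTheory GRing.Theory Num.Theory.
Import numFieldNormedType.Exports.
Local Open Scope classical_set_scope.
Local Open Scope ring_scope.

(** * Bounded measurable functions *)

Definition bounded_measurable d (X : measurableType d) (R : realType)
    (f : X -> R) : Prop :=
  measurable_fun setT f /\ exists C : R, forall x, `|f x| <= C.

Section BoundedMeasurable.
Context d (X : measurableType d) (R : realType).
Implicit Types f g : X -> R.

Lemma bounded_measurable_cst (c : R) :
  bounded_measurable (fun _ : X => c).
Proof. by split; [exact: measurable_cst|exists `|c|]. Qed.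

Lemma bounded_measurableD f g : bounded_measurable f -> bounded_measurable g ->
  bounded_measurable (fun x => f x + g x).
Proof.
move=> [mf [C fC]] [mg [D gD]]; split; first exact: measurable_funD.
by exists (C + D) => x; rewrite (le_trans (ler_normD _ _))// lerD.
Qed.

Lemma bounded_measurableM f g : bounded_measurable f -> bounded_measurable g ->
  bounded_measurable (fun x => f x * g x).
Proof.
move=> [mf [C fC]] [mg [D gD]]; split; first exact: measurable_funM.
by exists (C * D) => x; rewrite normrM ler_pM.
Qed.

Lemma bounded_measurableZ (c : R) f : bounded_measurable f ->
  bounded_measurable (fun x => c * f x).
Proof. by move=> bf; apply: bounded_measurableM => //; exact: bounded_measurable_cst. Qed.

Lemma bounded_measurableB f g : bounded_measurable f -> bounded_measurable g ->
  bounded_measurable (fun x => f x - g x).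
Proof.
move=> bf bg; rewrite (_ : (fun x => _) = fun x => f x + (-1) * g x); last first.
  by apply/funext => x; rewrite mulN1r.
by apply: bounded_measurableD => //; exact: bounded_measurableZ.
Qed.

Lemma bounded_measurable_indic (B : set X) : measurable B ->
  bounded_measurable (\1_B : X -> R).
Proof.
move=> mB; split; first exact: measurable_indic.
by exists 1 => x; rewrite indicE; case: (_ \in _); rewrite ?normr1// normr0.
Qed.

Lemma bounded_measurable_sum (n : nat) (F : nat -> X -> R) :
  (forall i, bounded_measurable (F i)) ->
  bounded_measurable (fun x => \sum_(i < n) F i x).
Proof.
move=> bF; elim: n => [|n IHn].
  rewrite (_ : (fun x => _) = fun=> 0); first exact: bounded_measurable_cst.
  by apply/funext => x; rewrite big_ord0.
rewrite (_ : (fun x => _) = fun x => \sum_(i < n) F i x + F n x).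
  exact: bounded_measurableD.
by apply/funext => x; rewrite big_ord_recr.
Qed.

Lemma bounded_measurable_integrable (mu : probability X R) f :
  bounded_measurable f -> mu.-integrable setT (EFin \o f).
Proof.
move=> [mf [C fC]]; apply: measurable_bounded_integrable => //.
  by rewrite (le_lt_trans (probability_le1 _ _))// ltry.
exists C; split; first exact: num_real.
by move=> M CM x _; exact: le_trans (fC x) (ltW CM).
Qed.

(** Bridge to [nonneg_definite], whose test functions range over L^2. *)
Lemma bounded_measurable_Lfun2 (mu : probability X R) f :
  bounded_measurable f -> f \in Lfun mu 2%:E.
Proof.
move=> bf; have [mf [C fC]] := bf.
rewrite inE; apply/andP; split; rewrite inE//=.
rewrite /finite_norm unlock /Lnorm poweR_lty//.
have b2 : bounded_measurable (fun x => `|f x| `^ 2).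
  rewrite (_ : (fun x => _) = fun x => f x * f x).
    exact: bounded_measurableM.
  by apply/funext => x; rewrite powR_mulrn// -normrX ger0_norm ?sqr_ge0.
by have /integrable_lty := bounded_measurable_integrable mu b2; exact.
Qed.

(** Continuity is for the sup norm, so such a functional is determined by its values on indicators.
    Integral identities are proved below by comparing two of them. *)
Definition bounded_linear (I : (X -> R) -> R) : Prop :=
  [/\ forall f g, bounded_measurable f -> bounded_measurable g ->
        I (fun x => f x + g x) = I f + I g,
      forall c f, bounded_measurable f -> I (fun x => c * f x) = c * I f
    & exists K, forall f e, bounded_measurable f -> (forall x, `|f x| <= e) ->
        `|I f| <= K * e].

Lemma bounded_linear_sum (I : (X -> R) -> R) n (F : nat -> X -> R) :
  bounded_linear I -> (forall i, bounded_measurable (F i)) ->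
  I (fun x => \sum_(i < n) F i x) = \sum_(i < n) I (F i).
Proof.
move=> [ID IZ _] bF; elim: n => [|n IHn].
  rewrite big_ord0 (_ : (fun x => _) = fun x => 0 * (fun=> 0) x).
    by rewrite IZ ?mul0r//; exact: bounded_measurable_cst.
  by apply/funext => x; rewrite big_ord0 mul0r.
rewrite big_ord_recr/= -IHn -ID//; last exact: bounded_measurable_sum.
by congr I; apply/funext => x; rewrite big_ord_recr.
Qed.

(** The sum is e times the minimum of n and the integer part of y / e. It is cut into levels so
    that, for y = h x, it becomes a combination of indicators of superlevel sets of h. *)
Lemma staircase_approx (e y : R) (n : nat) : 0 < e -> 0 <= y ->
  let s := \sum_(i < n) (if i.+1%:R * e <= y then e else 0) in
  s <= y /\ (y <= n%:R * e -> y <= s + e).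
Proof.
move=> e0 y0 /=; elim: n => [|n [IH1 IH2]].
  by rewrite big_ord0 mul0r add0r; split => // /le_trans; apply; exact: ltW.
rewrite big_ord_recr/=; case: ifPn => [ny|].
- have -> : \sum_(i < n) (if i.+1%:R * e <= y then e else 0) = n%:R * e.
    rewrite (eq_bigr (fun=> e)) ?sumr_const ?card_ord ?mulr_natl// => i _.
    rewrite ifT// (le_trans _ ny)// ler_pM2r// ler_nat ltnS.
    exact/ltnW/ltn_ord.
  by move: ny; rewrite -natr1 mulrDl mul1r; split => //; lra.
- rewrite -ltNge addr0 => ny; split => // _.
  have [yn|yn] := leP y (n%:R * e); first exact: IH2.
  have -> : \sum_(i < n) (if i.+1%:R * e <= y then e else 0) = n%:R * e.
    rewrite (eq_bigr (fun=> e)) ?sumr_const ?card_ord ?mulr_natl// => i _.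
    rewrite ifT// (le_trans _ (ltW yn))// ler_pM2r// ler_nat.
    exact: ltn_ord.
  by move: ny; rewrite -natr1 mulrDl mul1r => /ltW.
Qed.

(* Bounded measurable functions are uniform limits of simple functions. *)
Lemma bounded_linear_eq (I J : (X -> R) -> R) :
  bounded_linear I -> bounded_linear J ->
  (forall B, measurable B -> I \1_B = J \1_B) ->
  forall f, bounded_measurable f -> I f = J f.
Proof.
move=> lI lJ IJ f bf; have [ID IZ [K IK]] := lI; have [JD JZ [L JL]] := lJ.
have simple (n : nat) e (h : X -> R) : measurable_fun setT h ->
  let s := fun x => \sum_(i < n) (if i.+1%:R * e <= h x then e else 0) in
  bounded_measurable s /\ I s = J s.
  move=> mh /=; have mB (i : nat) : measurable [set x | i.+1%:R * e <= h x].
    rewrite -[X in measurable X]setTI.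
    exact: (measurable_fun_ler (@measurable_cst _ _ _ _ setT (i.+1%:R * e)) mh
      measurableT (Y := [set true])).
  have -> : (fun x => \sum_(i < n) (if i.+1%:R * e <= h x then e else 0)) =
     fun x => \sum_(i < n) (e * \1_[set x | i.+1%:R * e <= h x] x).
    apply/funext => x; apply: eq_bigr => i _; rewrite indicE.
    case: ifPn => hx; first by rewrite mem_set ?mulr1.
    by rewrite memNset ?mulr0//; exact/negP.
  have bB i : bounded_measurable (fun x => e * (\1_[set x | i.+1%:R * e <= h x] x : R)).
    by apply: bounded_measurableZ; exact: bounded_measurable_indic.
  split.
    exact: (@bounded_measurable_sum n
      (fun i x => e * (\1_[set x | i.+1%:R * e <= h x] x : R))).
  rewrite !(@bounded_linear_sum _ n
    (fun i x => e * (\1_[set x | i.+1%:R * e <= h x] x : R)))//.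
  apply: eq_bigr => i _.
  by rewrite IZ ?JZ ?IJ//; exact: bounded_measurable_indic.
have nonneg h : bounded_measurable h -> (forall x, 0 <= h x) -> I h = J h.
  move=> bh h0; have [mh [C hC]] := bh.
  apply/eqP; rewrite -subr_eq0 -normr_le0; apply/ler_addgt0Pr => e e0.
  (* [I] and [J] are at most (|K| + |L|) * e' in total on [h - s], hence this choice; the [+ 1]
     keeps the denominator positive. *)
  rewrite add0r; pose e' := e / (`|K| + `|L| + 1).
  have KL : 0 < `|K| + `|L| + 1 by rewrite ltr_pwDr// addr_ge0.
  have e'0 : 0 < e' by rewrite divr_gt0.
  (* Enough levels of height [e'] to climb above the bound [C] of [h]. *)
  have [bs IJs] := simple (Num.truncn (C / e')).+1 e' _ mh.
  set s := (fun x => _) in bs IJs.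
  have hs x : `|h x - s x| <= e'.
    have [s1 s2] := @staircase_approx e' (h x) (Num.truncn (C / e')).+1 e'0 (h0 x).
    rewrite ler_norml; apply/andP; split.
      by rewrite (@le_trans _ _ 0) ?oppr_le0 ?subr_ge0// ltW.
    rewrite lerBlDl; apply: s2.
    rewrite -ler_pdivrMr// ltW// (le_lt_trans _ (truncnS_gt _))//.
    rewrite ler_pM2r ?invr_gt0// (le_trans _ (hC x))// ler_norm //.
  have bhs := bounded_measurableB bh bs.
  have hE : h = fun x => s x + (h x - s x) by apply/funext => x; rewrite subrKC.
  rewrite {1 2}hE ID// JD// IJs opprD addrACA subrr add0r.
  rewrite (le_trans (ler_normB _ _))//.
  apply: le_trans (lerD (IK _ _ bhs hs) (JL _ _ bhs hs)) _.
  rewrite -mulrDl /e' mulrCA ger_pMr// ler_pdivrMr// mul1r.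
  by rewrite (le_trans (lerD (ler_norm _) (ler_norm _)))// lerDl.
have [mf [C fC]] := bf.
(* Both [f + C] and the constant [C] are nonnegative, so linearity reduces to the case [nonneg]. *)
have fE : f = fun x => (f x + C) + (-1) * C by apply/funext => x; rewrite mulN1r addrK.
have bC := bounded_measurable_cst.
have bN : bounded_measurable (fun=> -1 * C : R) := bC _.
have bfC := bounded_measurableD bf (bC C).
rewrite fE ID// JD// nonneg//; last first.
  by move=> x; move: (fC x); rewrite ler_norml => /andP[+ _]; lra.
rewrite (IZ _ (fun=> C))// (JZ _ (fun=> C))// nonneg// => x.
by rewrite (le_trans _ (fC x)).
Qed.

End BoundedMeasurable.

(** * Integration of bounded functions against a probability *)

Section Expectation.
Context d (X : measurableType d) (R : realType) (mu : probability X R).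
Implicit Types f g : X -> R.

Lemma RintD f g : bounded_measurable f -> bounded_measurable g ->
  \int[mu]_x (f x + g x) = \int[mu]_x f x + \int[mu]_x g x.
Proof.
by move=> bf bg; apply: RintegralD => //; exact: bounded_measurable_integrable.
Qed.

Lemma RintZ c f : bounded_measurable f ->
  \int[mu]_x (c * f x) = c * \int[mu]_x f x.
Proof. by move=> bf; apply: RintegralZl => //; exact: bounded_measurable_integrable. Qed.

Lemma RintB f g : bounded_measurable f -> bounded_measurable g ->
  \int[mu]_x (f x - g x) = \int[mu]_x f x - \int[mu]_x g x.
Proof.
by move=> bf bg; apply: RintegralB => //; exact: bounded_measurable_integrable.
Qed.

Lemma Rint_cst c : \int[mu]_(_ in setT) c = c.
Proof. by rewrite Rintegral_cst//= probability_setT mulr1. Qed.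

Lemma le_Rint f g : bounded_measurable f -> bounded_measurable g ->
  (forall x, f x <= g x) -> \int[mu]_x f x <= \int[mu]_x g x.
Proof.
by move=> bf bg fg; apply: le_Rintegral => //; exact: bounded_measurable_integrable.
Qed.

Lemma Rint_norm_le f e : bounded_measurable f -> (forall x, `|f x| <= e) ->
  `|\int[mu]_x f x| <= e.
Proof.
move=> bf fe; rewrite ler_norml -[X in _ && (_ <= X)]Rint_cst -[X in X <= _]Rint_cst.
by apply/andP; split; apply: le_Rint => //; try exact: bounded_measurable_cst;
  move=> x; move: (fe x); rewrite ler_norml => /andP[].
Qed.

Lemma Rint_indic (B : set X) : measurable B ->
  \int[mu]_x \1_B x = fine (mu B).
Proof. by move=> mB; rewrite /Rintegral integral_indic// setIT. Qed.

Lemma EFin_Rint f : bounded_measurable f ->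
  (\int[mu]_x (f x)%:E)%E = (\int[mu]_x f x)%:E.
Proof.
move=> bf; rewrite /Rintegral fineK//; apply: integrable_fin_num => //.
exact: bounded_measurable_integrable.
Qed.
End Expectation.

Lemma bounded_linear_Rint d (X : measurableType d) (R : realType)
    d2 (Y : measurableType d2) (mu : probability Y R)
    (T : (X -> R) -> Y -> R) (K : R) :
  (forall f, bounded_measurable f -> bounded_measurable (T f)) ->
  (forall f g y, bounded_measurable f -> bounded_measurable g ->
     T (fun x => f x + g x) y = T f y + T g y) ->
  (forall c f y, bounded_measurable f -> T (fun x => c * f x) y = c * T f y) ->
  (forall f e y, bounded_measurable f -> (forall x, `|f x| <= e) ->
     `|T f y| <= K * e) ->
  bounded_linear (fun f => \int[mu]_y T f y).
Proof.
move=> bT TD TZ TK; split.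
- move=> f g bf bg; rewrite -RintD; [|exact: bT..].
  by apply: eq_Rintegral => y _; exact: TD.
- move=> c f bf; rewrite -RintZ; last exact: bT.
  by apply: eq_Rintegral => y _; exact: TZ.
- by exists K => f e bf fe; apply: Rint_norm_le; [exact: bT|move=> y; exact: TK].
Qed.

Lemma Rint_sum d (X : measurableType d) (R : realType) (mu : probability X R)
    (N : nat) (F : nat -> X -> R) : (forall i, bounded_measurable (F i)) ->
  \int[mu]_x (\sum_(i < N) F i x) = \sum_(i < N) \int[mu]_x F i x.
Proof.
move=> bF; apply: (bounded_linear_sum (I := fun f => \int[mu]_x f x)) => //.
apply: (@bounded_linear_Rint _ _ _ _ _ mu (fun f : X -> R => f) 1) => // f e y _.
by rewrite mul1r; exact.
Qed.

(* [ge0_le_integral] also asks that [f] and [g] be measurable. *)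
Lemma ge0_le_integral_nonmeasurable d (X : measurableType d) (R : realType)
    (mu : {measure set X -> \bar R}) (f g : X -> \bar R) :
  (forall x, 0 <= f x)%E -> (forall x, f x <= g x)%E ->
  (\int[mu]_x f x <= \int[mu]_x g x)%E.
Proof.
move=> f0 fg; rewrite !ge0_integralTE//; last first.
  by move=> x; exact: le_trans (fg x).
by apply: ereal_sup_le => _ [h hf <-]; exists h => // x; exact: le_trans (fg x).
Qed.

(** * Transition operator and Markov property *)

Section TransitionOperator.
Context d (X : measurableType d) (R : realType) (P : R.-pker X ~> X).
Implicit Types f g : X -> R.

(* [P x] itself carries no canonical [probability] structure. *)
Definition pker_prob (x : X) : set X -> \bar R := P x.

HB.instance Definition _ x := Measure.on (pker_prob x).

HB.instance Definition _ x :=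
  Measure_isProbability.Build _ _ _ (pker_prob x) (prob_kernel x).

Definition pker_op f (x : X) : R := \int[pker_prob x]_y f y.

Lemma pker_opD f g x : bounded_measurable f -> bounded_measurable g ->
  pker_op (fun y => f y + g y) x = pker_op f x + pker_op g x.
Proof. exact: RintD. Qed.

Lemma pker_opZ c f x : bounded_measurable f ->
  pker_op (fun y => c * f y) x = c * pker_op f x.
Proof. exact: RintZ. Qed.

Lemma pker_opB f g x : bounded_measurable f -> bounded_measurable g ->
  pker_op (fun y => f y - g y) x = pker_op f x - pker_op g x.
Proof. exact: RintB. Qed.

Lemma pker_op_cst c x : pker_op (fun=> c) x = c.
Proof. exact: Rint_cst. Qed.

Lemma pker_op_indic (B : set X) x : measurable B ->
  pker_op \1_B x = fine (P x B).
Proof. exact: Rint_indic. Qed.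

Lemma le_pker_op f g x : bounded_measurable f -> bounded_measurable g ->
  (forall y, f y <= g y) -> pker_op f x <= pker_op g x.
Proof. exact: le_Rint. Qed.

Lemma pker_op_norm_le f e x : bounded_measurable f ->
  (forall y, `|f y| <= e) -> `|pker_op f x| <= e.
Proof. exact: Rint_norm_le. Qed.

Lemma pker_op_sum (N : nat) (F : nat -> X -> R) x :
  (forall i, bounded_measurable (F i)) ->
  pker_op (fun y => \sum_(i < N) F i y) x = \sum_(i < N) pker_op (F i) x.
Proof. exact: Rint_sum. Qed.

Lemma pker_op_norm_op f x : bounded_measurable f ->
  `|pker_op f x| <= pker_op (fun y => `|f y|) x.
Proof.
by move=> bf; apply: le_normr_Rintegral => //; exact: bounded_measurable_integrable.
Qed.

Lemma bounded_measurable_pker_op f : bounded_measurable f ->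
  bounded_measurable (pker_op f).
Proof.
move=> bf; have [mf [C fC]] := bf.
split; last by exists C => x; exact: pker_op_norm_le.
have bC := @bounded_measurable_cst _ X R C.
have bfC := bounded_measurableD bf bC.
(* The measurability of kernel integrals is used for nonnegative integrands, hence the shift by
   [C]. *)
have -> : pker_op f = fun x => pker_op (fun y => f y + C) x - C.
  by apply/funext => x; rewrite pker_opD// pker_op_cst addrK.
apply: measurable_funB => //; apply/measurable_EFinP.
rewrite (_ : _ \o _ = fun x => (\int[P x]_y (f y + C)%:E)%E); last first.
  by apply/funext => x; apply/esym; exact: (EFin_Rint (pker_prob x)).
apply: measurable_fun_integral_kernel.
- by move=> U mU; exact: measurable_kernel.
- by move=> y; rewrite lee_fin; move: (fC y); rewrite ler_norml => /andP[+ _]; lra.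
- by apply/measurable_EFinP; case: bfC.
Qed.

(** The indicator tests the point that is left, not the one that is reached, in keeping with sigma_A
    counting time 0: the n-th iterate at x is the expectation of f(Phi_n) on sigma_A >= n. *)
Definition killed_op (A : set X) f x := \1_(~` A) x * pker_op f x.

Lemma bounded_measurable_killed_op A f : measurable A -> bounded_measurable f ->
  bounded_measurable (killed_op A f).
Proof.
move=> mA bf; apply: bounded_measurableM; last exact: bounded_measurable_pker_op.
by apply: bounded_measurable_indic; exact: measurableC.
Qed.

Lemma bounded_measurable_iter_killed_op A f n : measurable A ->
  bounded_measurable f -> bounded_measurable (iter n (killed_op A) f).
Proof.
by move=> mA bf; elim: n => //= n IHn; exact: bounded_measurable_killed_op.
Qed.

Lemma killed_op0 : killed_op set0 = pker_op.
Proof.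
by apply/funext => f; apply/funext => x; rewrite /killed_op setC0 indicT mul1r.
Qed.

End TransitionOperator.

(** * Markov property for bounded functions and for the killed chain *)

Section MarkovProperty.
Context d d' (R : realType) (X : measurableType d) (W : measurableType d')
  (P : R.-pker X ~> X) (Px : X -> probability W R)
  (Phi : nat -> {mfun W >-> X}) (hPhi : markov_chain P Px Phi).

(* The event sigma_A >= n. *)
Fixpoint avoid (A : set X) (n : nat) : set W :=
  if n is m.+1 then avoid A m `&` Phi m @^-1` (~` A) else setT.

Lemma sub_natural_filtration m n : (m <= n)%N ->
  natural_filtration Phi m `<=` natural_filtration Phi n.
Proof.
move=> mn; apply: sub_sigma_algebra2 => B [k/= km HB].
by exists k => //=; exact: leq_trans mn.
Qed.

(** The event constrains times 0 to n only, so the Markov property applies to it at time n. *)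
Lemma avoid_filtration A n : measurable A ->
  natural_filtration Phi n (avoid A n.+1).
Proof.
move=> mA.
have filtC m : natural_filtration Phi m (Phi m @^-1` (~` A)).
  apply: sub_sigma_algebra; exists m => //=.
  by exists (~` A); [exact: measurableC|rewrite setTI].
elim: n => [|n IHn]; first by rewrite /= setTI.
(* Only closure under binary intersections is kept. *)
have [_ _ _ +] := (sigma_algebraP (fun B _ => @subsetT _ B)).1
  (smallest_sigma_algebra setT
    (\bigcup_(k in [set k | (k <= n.+1)%N])
        preimage_set_system setT (Phi k) measurable)).
by apply; [exact: (sub_natural_filtration (leqnSn n))|exact: filtC].
Qed.

Lemma measurable_avoid A n : measurable A -> measurable (avoid A n).
Proof.
move=> mA; elim: n => //= n IHn; apply: measurableI => //.
by rewrite -[X in measurable X]setTI; apply: measurable_funP => //; exact: measurableC.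
Qed.

Lemma bounded_measurable_restrict_chain (F : set W) n (f : X -> R) :
  measurable F -> bounded_measurable f ->
  bounded_measurable (fun w => \1_F w * f (Phi n w)).
Proof.
move=> mF [mf [C fC]]; apply: bounded_measurableM.
  exact: bounded_measurable_indic.
by split; [exact: measurableT_comp|exists C => w; exact: fC].
Qed.

Lemma norm_indicM_le (F : set W) w (y e : R) : `|y| <= e -> `|\1_F w * y| <= 1 * e.
Proof.
move=> ye; rewrite normrM ler_pM// indicE; case: (_ \in _).
  by rewrite normr1.
by rewrite normr0.
Qed.

Lemma bounded_linear_chain (F : set W) n x : measurable F ->
  bounded_linear (fun f : X -> R => \int[Px x]_w (\1_F w * f (Phi n w))).
Proof.
move=> mF; apply: (@bounded_linear_Rint _ _ _ _ _ _ _ 1).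
- by move=> f bf; exact: bounded_measurable_restrict_chain.
- by move=> f g w _ _; rewrite mulrDr.
- by move=> c f w _; rewrite mulrCA.
- by move=> f e w _ fe; exact: norm_indicM_le.
Qed.

Lemma bounded_linear_chain_op (F : set W) n x : measurable F ->
  bounded_linear (fun f : X -> R => \int[Px x]_w (\1_F w * pker_op P f (Phi n w))).
Proof.
move=> mF; apply: (@bounded_linear_Rint _ _ _ _ _ _ _ 1).
- move=> f bf; apply: bounded_measurable_restrict_chain => //.
  exact: bounded_measurable_pker_op.
- by move=> f g w bf bg; rewrite pker_opD// mulrDr.
- by move=> c f w bf; rewrite pker_opZ// mulrCA.
- by move=> f e w bf fe; apply: norm_indicM_le; exact: pker_op_norm_le.
Qed.

(** For an indicator this is the defining identity of [markov_chain]; both sides are sup-norm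
    continuous and linear in f. *)
Lemma markov_pker_op (F : set W) n x f : measurable F ->
  natural_filtration Phi n F -> bounded_measurable f ->
  \int[Px x]_w (\1_F w * f (Phi n.+1 w)) =
  \int[Px x]_w (\1_F w * pker_op P f (Phi n w)).
Proof.
move=> mF hF bf; move: f bf; apply: bounded_linear_eq.
- exact: bounded_linear_chain.
- exact: bounded_linear_chain_op.
move=> B mB; have mPB : measurable (Phi n.+1 @^-1` B).
  by rewrite -[X in measurable X]setTI; exact: measurable_funP.
transitivity (\int[Px x]_w \1_(F `&` Phi n.+1 @^-1` B) w).
  by apply: eq_Rintegral => w _; rewrite indicI.
rewrite Rint_indic; last exact: measurableI.
case: hPhi => _ /(_ x n F B hF mB) ->.
rewrite /Rintegral [in LHS]integral_mkcond; congr fine; apply: eq_integral => w _.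
rewrite patchE indicE pker_op_indic//; case: ifPn => _; last by rewrite mul0r.
by rewrite mul1r fineK// (fin_num_measure (pker_prob P _)).
Qed.

(** Induction removes the last step of the path: the Markov property turns f at time n + 1 into P f
    at time n, and the condition that Phi_n is off A turns P f into the killed operator. Hence f
    varies in the induction. *)
Lemma avoid_expectation A n x f : measurable A -> bounded_measurable f ->
  \int[Px x]_w (\1_(avoid A n) w * f (Phi n w)) = iter n (killed_op P A) f x.
Proof.
move=> mA; elim: n f => [|n IHn] f bf /=.
  transitivity (\int[distribution (Px x) (Phi 0%N)]_y f y).
    have [mf [C fC]] := bf.
    have ifPhi : (Px x).-integrable setT ((EFin \o f) \o Phi 0%N).
      apply: (@bounded_measurable_integrable _ _ _ _ (f \o Phi 0%N)).
      by split; [exact: measurableT_comp|exists C => w; exact: fC].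
    have mf' : measurable_fun setT (EFin \o f) by exact/measurable_EFinP.
    rewrite /Rintegral (integral_distribution mf' ifPhi); congr fine.
    by apply: eq_integral => w _ /=; rewrite indicT mul1r.
  have mf' : measurable_fun setT (EFin \o f) by apply/measurable_EFinP; case: bf.
  have law B : measurable B -> B `<=` setT ->
      distribution (Px x) (Phi 0%N) B = \d_x B.
    by move=> mB _; case: hPhi => + _; exact.
  by rewrite /Rintegral (eq_measure_integral _ law) integral_dirac// diracT mul1e.
rewrite markov_pker_op//; last 2 first.
  exact: (@measurable_avoid A n.+1).
  exact: (@avoid_filtration A n).
rewrite -iterS iterSr -IHn; last exact: bounded_measurable_killed_op.
by apply: eq_Rintegral => w _; rewrite indicI/= mulrA.
Qed.

Lemma avoid_set0 n : avoid set0 n = setT.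
Proof. by elim: n => //= n ->; rewrite setC0 preimage_setT setIT. Qed.

Lemma nstep_expectation n x f : bounded_measurable f ->
  (\int[nstep Px Phi n x]_y (f y)%:E)%E = (iter n (pker_op P) f x)%:E.
Proof.
move=> bf; have [mf [C fC]] := bf.
have bfn : bounded_measurable (f \o Phi n).
  by split; [exact: measurableT_comp|exists C => w; exact: fC].
have mf' : measurable_fun setT (EFin \o f) by exact/measurable_EFinP.
rewrite (integral_distribution mf' (bounded_measurable_integrable (Px x) bfn)).
(* With [A] empty nothing is killed and [avoid] is the sure event. *)
rewrite -killed_op0 -avoid_expectation//.
transitivity (\int[Px x]_w (f \o Phi n) w)%:E; first exact: EFin_Rint.
by congr EFin; apply: eq_Rintegral => w _; rewrite /= avoid_set0 indicT mul1r.
Qed.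

End MarkovProperty.

(** * Truncated expectation of the hitting time *)

Section HittingTime.
Context d d' (R : realType) (X : measurableType d) (W : measurableType d')
  (P : R.-pker X ~> X) (Px : X -> probability W R)
  (Phi : nat -> {mfun W >-> X}) (hPhi : markov_chain P Px Phi).

Lemma avoidP (A : set X) n w : avoid Phi A n w ->
  forall i, (i < n)%N -> ~ A (Phi i w).
Proof.
elim: n => //= n IHn [/IHn h nA] i; rewrite ltnS leq_eqVlt => /predU1P[->//|].
exact: h.
Qed.

(** Truncation of sigma_A = sum over k of 1(sigma_A > k). If time n is a visit to A, only terms with
    k < n survive; without a visit the infimum is +oo. *)
Lemma sum_avoid_le_hitting_time (A : set X) N w :
  ((\sum_(k < N) \1_(avoid Phi A k.+1) w)%:E <= hitting_time R Phi A w)%E.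
Proof.
apply: le_ereal_inf_tmp => _ [n An <-]; rewrite lee_fin.
have le_ind (k : nat) : \1_(avoid Phi A k.+1) w <= (k < n)%:R :> R.
  rewrite indicE ler_nat; case: ltnP => kn; first by case: (_ \in _).
  by rewrite memNset// => /avoidP/(_ n); apply.
apply: (@le_trans _ _ (\sum_(k < N) (k < n)%:R)).
  by apply: ler_sum => k _; exact: le_ind.
rewrite -natr_sum ler_nat; apply: (@leq_trans (minn N n)); last exact: geq_minr.
elim: N => [|N IHN]; first by rewrite big_ord0.
by rewrite big_ord_recr/= (leq_trans (leq_add IHN (leqnn _)))//; case: ltnP; lia.
Qed.

Lemma sum_killed_op_le (A : set X) (M : R) N x : measurable A ->
  ereal_sup (range (fun x : X => (\int[Px x]_w hitting_time R Phi A w)%E)) = M%:E ->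
  \sum_(k < N) iter k.+1 (killed_op P A) (fun=> 1) x <= M.
Proof.
move=> mA hM.
have b1 := @bounded_measurable_cst _ X R 1.
have bi k : bounded_measurable (\1_(avoid Phi A k.+1) : W -> R).
  by apply: bounded_measurable_indic; exact: measurable_avoid.
have bs := bounded_measurable_sum N bi.
have -> : \sum_(k < N) iter k.+1 (killed_op P A) (fun=> 1) x =
    \int[Px x]_w \sum_(k < N) \1_(avoid Phi A k.+1) w.
  rewrite (Rint_sum _ _ bi); apply: eq_bigr => k _.
  rewrite -(avoid_expectation hPhi)//; apply: eq_Rintegral => w _.
  by rewrite mulr1.
rewrite -lee_fin -EFin_Rint// -hM; apply: le_ereal_sup_tmp.
exists (\int[Px x]_w hitting_time R Phi A w)%E; first by exists x.
(* This comparison spares a measurability proof for [hitting_time]. *)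
apply: ge0_le_integral_nonmeasurable => w; last exact: sum_avoid_le_hitting_time.
by rewrite lee_fin sumr_ge0// => k _; rewrite indicE.
Qed.

End HittingTime.

(** * Reversible kernels *)

(** The minimum is at t = - b / c. The case c = 0 is kept because the forms below may be degenerate;
    there b must vanish. *)
Lemma quadratic_ge0_discriminant (R : realFieldType) (a b c : R) : 0 <= c ->
  (forall t : R, 0 <= a + 2 * t * b + t ^+ 2 * c) -> b ^+ 2 <= a * c.
Proof.
rewrite le_eqVlt => /predU1P[<-|c0] h.
  have [->|b0] := eqVneq b 0; first by rewrite expr0n mulr0.
  (* This t gives the affine function the value -1. *)
  have := h (- (a + 1) / (2 * b)).
  have -> : a + 2 * (- (a + 1) / (2 * b)) * b + (- (a + 1) / (2 * b)) ^+ 2 * 0 = -1.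
    by field.
  by rewrite oppr_ge0 ler10.
have := h (- b / c).
have -> : a + 2 * (- b / c) * b + (- b / c) ^+ 2 * c = (a * c - b ^+ 2) / c.
  by field; rewrite gt_eqF.
by rewrite pmulr_lge0 ?invr_gt0// subr_ge0.
Qed.

Lemma bernoulli_ineq (R : realFieldType) (d : R) n : 0 <= d ->
  1 + n%:R * d <= (1 + d) ^+ n.
Proof.
move=> d0; elim: n => [|n IHn]; first by rewrite mul0r addr0 expr0.
rewrite exprS; apply: (@le_trans _ _ ((1 + d) * (1 + n%:R * d))).
  have : 0 <= n%:R * d * d by rewrite !mulr_ge0.
  by rewrite -natr1; lra.
by rewrite ler_wpM2l// addr_ge0.
Qed.

Lemma expr_unbounded (R : archiRealFieldType) (r C : R) : 1 < r ->
  exists n, C < r ^+ n.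
Proof.
move=> r1; have d0 : 0 < r - 1 by rewrite subr_gt0.
exists (Num.truncn (C / (r - 1))).+1.
have := bernoulli_ineq (Num.truncn (C / (r - 1))).+1 (ltW d0).
rewrite subrKC => /(lt_le_trans _); apply.
rewrite (@lt_trans _ _ ((Num.truncn (C / (r - 1))).+1%:R * (r - 1)))//.
  by rewrite -ltr_pdivrMr// truncnS_gt.
by rewrite ltrDr.
Qed.

(* The ratios b (n+1) / b n of a log-convex sequence increase, so the first
   one is at most the exponential growth rate. *)
Lemma log_convex_first_ratio_le (R : archiRealFieldType) (b : nat -> R) (s C : R) :
  0 < s -> (forall k, 0 <= b k) ->
  (forall k, b k.+1 ^+ 2 <= b k * b k.+2) ->
  (forall k, b k <= C * s ^+ k) -> b 1 <= s * b 0.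
Proof.
move=> s0 b0 bconv bC; rewrite leNgt; apply/negP => lt_b.
have b1_gt0 : 0 < b 1 by rewrite (le_lt_trans _ lt_b)// mulr_ge0// ltW.
have b0_gt0 : 0 < b 0.
  rewrite lt_neqAle b0 andbT; apply/eqP => b00.
  by have := bconv 0; rewrite -b00 mul0r leNgt exprn_gt0.
pose r := b 1 / b 0; have r0 : 0 < r by rewrite divr_gt0.
have step k : 0 < b k /\ r * b k <= b k.+1.
  elim: k => [|k [bk rk]]; first by rewrite b0_gt0 divfK// gt_eqF.
  have bk1 : 0 < b k.+1 by rewrite (lt_le_trans _ rk)// mulr_gt0.
  split => //; rewrite -(ler_pM2l bk) (le_trans _ (bconv k))//.
  by rewrite mulrCA mulrA expr2 ler_pM2r.
have geo k : b 0 * r ^+ k <= b k.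
  elim: k => [|k IHk]; first by rewrite expr0 mulr1.
  by rewrite exprS mulrCA (le_trans _ (step k).2)// ler_pM2l.
(* By [lt_b] the first ratio r exceeds s, so [b 0 * r ^+ k] outgrows [C * s ^+ k]. *)
have rs1 : 1 < r / s by rewrite ltr_pdivlMr// mul1r ltr_pdivlMr.
have [n] := expr_unbounded (C / b 0) rs1.
rewrite ltr_pdivrMr// => /lt_geF/negP; apply.
rewrite expr_div_n mulrAC ler_pdivrMr ?exprn_gt0//.
by rewrite (le_trans _ (bC n))// mulrC.
Qed.

Ltac bmeas := repeat (first [ assumption
  | exact: bounded_measurable_cst
  | apply: bounded_measurable_indic; first [assumption | exact: measurableC]
  | apply: bounded_measurable_pker_op
  | apply: bounded_measurable_killed_op; [assumption|]
  | apply: bounded_measurable_iter_killed_op; [assumption|]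
  | apply: bounded_measurableD
  | apply: bounded_measurableB
  | apply: bounded_measurableM ]).

(** * The L^2 scalar product on bounded functions *)

Section InnerProduct.
Context d (X : measurableType d) (R : realType) (mu : probability X R).
Implicit Types f g h : X -> R.

Definition inner f g := \int[mu]_x (f x * g x).

Lemma innerC f g : inner f g = inner g f.
Proof. by apply: eq_Rintegral => x _; rewrite mulrC. Qed.

Lemma inner_ge0 f : 0 <= inner f f.
Proof. by apply: Rintegral_ge0 => x _; exact: sqr_ge0. Qed.

Lemma inner_norm_le f g a b : bounded_measurable f -> bounded_measurable g ->
  (forall x, `|f x| <= a) -> (forall x, `|g x| <= b) -> `|inner f g| <= a * b.
Proof.
move=> bf bg fa gb; apply: Rint_norm_le; first exact: bounded_measurableM.
by move=> x; rewrite normrM ler_pM.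
Qed.

Lemma innerDl f g h : bounded_measurable f -> bounded_measurable g ->
  bounded_measurable h -> inner (fun x => f x + g x) h = inner f h + inner g h.
Proof.
move=> bf bg bh; rewrite -RintD; [|bmeas..].
by apply: eq_Rintegral => x _; rewrite mulrDl.
Qed.

Lemma innerZl c f g : bounded_measurable f -> bounded_measurable g ->
  inner (fun x => c * f x) g = c * inner f g.
Proof.
move=> bf bg; rewrite -RintZ; last bmeas.
by apply: eq_Rintegral => x _; rewrite mulrA.
Qed.

Lemma innerDr f g h : bounded_measurable f -> bounded_measurable g ->
  bounded_measurable h -> inner h (fun x => f x + g x) = inner h f + inner h g.
Proof. by move=> bf bg bh; rewrite innerC innerDl// !(innerC h). Qed.

Lemma innerZr c f g : bounded_measurable f -> bounded_measurable g ->
  inner g (fun x => c * f x) = c * inner g f.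
Proof. by move=> bf bg; rewrite innerC innerZl// (innerC g). Qed.

Lemma inner1l f : inner (fun=> 1) f = \int[mu]_x f x.
Proof. by apply: eq_Rintegral => x _; rewrite mul1r. Qed.

Lemma inner_cauchy_schwarz f g : bounded_measurable f -> bounded_measurable g ->
  inner f g ^+ 2 <= inner f f * inner g g.
Proof.
move=> bf bg; apply: quadratic_ge0_discriminant; first exact: inner_ge0.
move=> t; have btg := bounded_measurableZ t bg.
have := inner_ge0 (fun x => f x + t * g x).
rewrite innerDl ?innerDr ?innerZl ?innerZr//; try by bmeas.
rewrite (innerC g f) => /le_trans; apply.
by rewrite le_eqVlt; apply/orP; left; apply/eqP; ring.
Qed.

End InnerProduct.

(** * Self-adjointness and positivity of the transition operator *)

Section Reversible.
Context d (X : measurableType d) (R : realType) (P : R.-pker X ~> X)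
  (pi : probability X R) (hrev : reversible P pi) (hpos : nonneg_definite P pi).
Implicit Types f g h : X -> R.

(** Reversibility tested on the rectangle B x C, whose sections are C, B or empty. *)
Lemma inner_pker_op_indic (B C : set X) : measurable B -> measurable C ->
  inner pi \1_B (pker_op P \1_C) = inner pi (pker_op P \1_B) \1_C.
Proof.
move=> mB mC; have := hrev (measurableX mB mC).
have PxE x (D : set X) : measurable D -> (pker_op P \1_D x)%:E = P x D.
  move=> mD; rewrite pker_op_indic// fineK//.
  exact: (fin_num_measure (pker_prob P x)).
have lE : (\int[pi]_x P x (xsection (B `*` C) x))%E =
    (\int[pi]_x (\1_B x * pker_op P \1_C x)%:E)%E.
  apply: eq_integral => x _; rewrite EFinM PxE// indicE.
  have [xB|xB] := boolP (x \in B); first by rewrite in_xsectionX// mul1e.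
  by rewrite notin_xsectionX// measure0 mul0e.
have rE : (\int[pi]_x P x (ysection (B `*` C) x))%E =
    (\int[pi]_x (pker_op P \1_B x * \1_C x)%:E)%E.
  apply: eq_integral => x _; rewrite EFinM PxE// indicE.
  have [xC|xC] := boolP (x \in C); first by rewrite in_ysectionX// mule1.
  by rewrite notin_ysectionX// measure0 mule0.
by rewrite lE rE => /(congr1 fine).
Qed.

Lemma bounded_linear_inner_op g : bounded_measurable g ->
  bounded_linear (fun f => inner pi g (pker_op P f)).
Proof.
move=> bg; have [mg [C gC]] := bg.
apply: (@bounded_linear_Rint _ _ _ _ _ pi (fun f x => g x * pker_op P f x) C).
- by move=> f bf; bmeas.
- by move=> f1 f2 x b1 b2; rewrite pker_opD// mulrDr.
- by move=> c f x bf; rewrite pker_opZ// mulrCA.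
- by move=> f e x bf fe; rewrite normrM ler_pM// pker_op_norm_le.
Qed.

Lemma bounded_linear_inner g : bounded_measurable g ->
  bounded_linear (fun f => inner pi g f).
Proof.
move=> bg; have [mg [C gC]] := bg.
apply: (@bounded_linear_Rint _ _ _ _ _ pi (fun f x => g x * f x) C).
- by move=> f bf; bmeas.
- by move=> f1 f2 x b1 b2; rewrite mulrDr.
- by move=> c f x bf; rewrite mulrCA.
- by move=> f e x bf fe; rewrite normrM ler_pM.
Qed.

(** Extended from indicators one argument at a time. *)
Lemma inner_pker_op f g : bounded_measurable f -> bounded_measurable g ->
  inner pi f (pker_op P g) = inner pi (pker_op P f) g.
Proof.
move=> bf bg; move: g bg; apply: bounded_linear_eq.
- exact: bounded_linear_inner_op.
- by apply: bounded_linear_inner; bmeas.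
move=> C mC; rewrite innerC [RHS]innerC; have b1C : bounded_measurable (\1_C : X -> R).
  by bmeas.
move: f bf; apply: bounded_linear_eq.
- by apply: bounded_linear_inner; bmeas.
- exact: bounded_linear_inner_op.
- by move=> B mB; rewrite innerC inner_pker_op_indic// innerC.
Qed.

Lemma bounded_measurable_iter_pker_op n f : bounded_measurable f ->
  bounded_measurable (iter n (pker_op P) f).
Proof. by move=> bf; elim: n => //= n IHn; bmeas. Qed.

Lemma inner_iter_pker_op n f g : bounded_measurable f -> bounded_measurable g ->
  inner pi f (iter n (pker_op P) g) = inner pi (iter n (pker_op P) f) g.
Proof.
elim: n f => //= n IHn f bf bg; rewrite inner_pker_op//.
  by rewrite IHn//; [rewrite -iterSr|bmeas].
exact: bounded_measurable_iter_pker_op.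
Qed.

(** Self-adjointness against the constant 1, which P fixes. *)
Lemma Rint_pker_op f : bounded_measurable f ->
  \int[pi]_x pker_op P f x = \int[pi]_x f x.
Proof.
move=> bf; rewrite -inner1l -[RHS]inner1l inner_pker_op//; last bmeas.
by apply: eq_Rintegral => x _; rewrite pker_op_cst.
Qed.

Lemma Rint_iter_pker_op n f : bounded_measurable f ->
  \int[pi]_x iter n (pker_op P) f x = \int[pi]_x f x.
Proof.
move=> bf; elim: n => //= n <-; apply: Rint_pker_op.
exact: bounded_measurable_iter_pker_op.
Qed.

Lemma inner_pker_op_ge0 f : bounded_measurable f -> 0 <= inner pi f (pker_op P f).
Proof. by move=> bf; apply: hpos; exact: bounded_measurable_Lfun2. Qed.

Lemma pker_op_cauchy_schwarz f g : bounded_measurable f -> bounded_measurable g ->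
  inner pi f (pker_op P g) ^+ 2 <= inner pi f (pker_op P f) * inner pi g (pker_op P g).
Proof.
move=> bf bg; apply: quadratic_ge0_discriminant; first exact: inner_pker_op_ge0.
move=> t; have btg := bounded_measurableZ t bg.
have := inner_pker_op_ge0 (bounded_measurableD bf btg).
have -> : pker_op P (fun x => f x + t * g x) =
    fun x => pker_op P f x + t * pker_op P g x.
  by apply/funext => x; rewrite pker_opD// pker_opZ.
rewrite innerDl ?innerDr ?innerZl ?innerZr//; try by bmeas.
rewrite (inner_pker_op bg bf) (innerC _ _ f) => /le_trans; apply.
by rewrite le_eqVlt; apply/orP; left; apply/eqP; ring.
Qed.

End Reversible.

(** * Kernels with an atom *)

Section KilledChain.
Context d (X : measurableType d) (R : realType) (P : R.-pker X ~> X)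
  (A : set X) (mA : measurable A).
Implicit Types f g h : X -> R.

Local Notation Q := (killed_op P A).
(* For the chain started at [x], the probability that sigma_A >= n. *)
Definition hit_tail n : X -> R := iter n (killed_op P A) (fun=> 1).

Lemma killed_op_in f x : A x -> Q f x = 0.
Proof. by move=> Ax; rewrite /killed_op indicE memNset ?mul0r//; exact. Qed.

Lemma killed_op_notin f x : ~ A x -> Q f x = pker_op P f x.
Proof. by move=> Ax; rewrite /killed_op indicE mem_set ?mul1r. Qed.

Lemma bounded_measurable_hit_tail n : bounded_measurable (hit_tail n).
Proof. by rewrite /hit_tail; bmeas. Qed.

Lemma hit_tail_ge0 n x : 0 <= hit_tail n x.
Proof.
elim: n x => [//|n IHn] x; rewrite /hit_tail /=.
have [Ax|Ax] := pselect (A x); first by rewrite killed_op_in.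
by rewrite killed_op_notin//; apply: Rintegral_ge0 => y _; exact: IHn.
Qed.

(** The killed operator Q is positive, so |Q^n f| <= Q^n |f| <= C Q^n 1. *)
Lemma iter_killed_op_le n f C x : bounded_measurable f ->
  (forall x, `|f x| <= C) -> `|iter n Q f x| <= C * hit_tail n x.
Proof.
move=> bf fC; elim: n x => [|n IHn] x; first by rewrite mulr1.
rewrite /hit_tail /=; have [Ax|Ax] := pselect (A x).
  by rewrite !killed_op_in// normr0 mulr0.
have bt := bounded_measurable_hit_tail n.
rewrite !killed_op_notin// -pker_opZ//.
have bQ : bounded_measurable (iter n Q f) by bmeas.
rewrite (le_trans (pker_op_norm_op _ _ bQ))//; apply: le_pker_op => //.
- have [mQ [D QD]] := bQ; split; first exact: measurableT_comp.
  by exists D => y; rewrite normr_id.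
- by bmeas.
Qed.

(* The function [1 + c * E_x(sigma_A)] is a Lyapunov function; truncated sums
   replace the expectation so that no limit is needed. *)
Lemma hit_tail_geometric (M l : R) : 1 < l -> M * (1 - l^-1) < 1 ->
  (forall N x, \sum_(k < N) hit_tail k.+1 x <= M) ->
  forall n x, hit_tail n x <= (1 - M * (1 - l^-1))^-1 * l ^- n.
Proof.
move=> l1 Ms SM n x; set s := 1 - l^-1 in Ms *.
have l0 : 0 < l := lt_trans ltr01 l1.
have s0 : 0 <= s by rewrite subr_ge0 invf_le1// ltW.
have Ms0 : 0 < 1 - M * s by rewrite subr_gt0.
(* Chosen so that 1 + c M = 1 / (1 - M s), that is, s (1 + c M) = c. *)
pose c := s / (1 - M * s); have c0 : 0 <= c by rewrite divr_ge0// ltW.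
pose S n x := \sum_(k < n) hit_tail k.+1 x.
have V n' y : 1 + c * S n' y <= (1 - M * s)^-1.
  apply: (@le_trans _ _ (1 + c * M)); first by rewrite lerD2l ler_wpM2l// SM.
  by rewrite le_eqVlt; apply/orP; left; apply/eqP; rewrite /c; field; rewrite gt_eqF.
suff tS : hit_tail n x <= l ^- n * (1 + c * S n x).
  by rewrite (le_trans tS)// [leRHS]mulrC ler_wpM2l// invr_ge0 exprn_ge0// ltW.
elim: n x => [|n IHn] x; first by rewrite /S big_ord0 mulr0 addr0 expr0 invr1 mulr1.
have S_ge0 y m : 0 <= S m y by apply: sumr_ge0 => k _; exact: hit_tail_ge0.
rewrite {1}/hit_tail/=; have [Ax|Ax] := pselect (A x).
  rewrite killed_op_in// mulr_ge0// ?invr_ge0 ?exprn_ge0 ?(ltW l0)//.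
  by rewrite addr_ge0// mulr_ge0.
rewrite killed_op_notin//.
have bt k := bounded_measurable_hit_tail k.+1.
have bS : bounded_measurable (S n) := bounded_measurable_sum n bt.
have b1 := @bounded_measurable_cst _ X R 1.
apply: (@le_trans _ _ (pker_op P (fun y => l ^- n * (1 + c * S n y)) x)).
  apply: le_pker_op => //; first exact: bounded_measurable_hit_tail.
  by bmeas.
rewrite pker_opZ; last by bmeas.
rewrite pker_opD ?pker_op_cst ?pker_opZ//; last by bmeas.
(* Off A, P sends [hit_tail k.+1] to [hit_tail k.+2]; the missing first term is [hit_tail 1] = 1. *)
have -> : pker_op P (S n) x = S n.+1 x - 1.
  rewrite (pker_op_sum P n x bt) /S big_ord_recl/= killed_op_notin//.
  rewrite pker_op_cst addrAC subrr add0r; apply: eq_bigr => k _.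
  by rewrite killed_op_notin.
rewrite exprSr invfM -[leRHS]mulrA ler_wpM2l ?invr_ge0 ?exprn_ge0 ?(ltW l0)//.
(* Equivalent to the drift inequality 1 + c (S - 1) <= (1 + c S) / l, as 1 / l = 1 - s. *)
have : s * (1 + c * S n.+1 x) <= c by rewrite ler_wpM2l// V.
by rewrite /s; lra.
Qed.

End KilledChain.

(** * Norm of the killed kernel *)

Section KilledNorm.
Context d (X : measurableType d) (R : realType) (P : R.-pker X ~> X)
  (pi : probability X R) (A : set X) (mA : measurable A)
  (hrev : reversible P pi).
Implicit Types f g h : X -> R.

Local Notation Q := (killed_op P A).

(** On functions vanishing on A, Q is P compressed to the complement of A. *)
Lemma inner_killed_op f g : bounded_measurable f -> bounded_measurable g ->
  (forall x, A x -> f x = 0) -> (forall x, A x -> g x = 0) ->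
  inner pi (Q f) g = inner pi f (Q g).
Proof.
move=> bf bg f0 g0.
transitivity (inner pi (pker_op P f) g).
  apply: eq_Rintegral => x _; have [Ax|Ax] := pselect (A x).
    by rewrite g0// !mulr0.
  by rewrite killed_op_notin.
rewrite -inner_pker_op//; apply: eq_Rintegral => x _.
have [Ax|Ax] := pselect (A x); first by rewrite f0// !mul0r.
by rewrite killed_op_notin.
Qed.

(** The squared norms of Q^k g are log-convex because Q is self-adjoint, and are O(l^(-2k)) by the
    tail bound. Hence |Q g| <= |g| / l: the constant [K] and the sup bound of g are lost, only the
    rate remains. *)
Lemma killed_form_le (l K : R) g : 1 < l ->
  (forall n x, hit_tail P A n x <= K * l ^- n) ->
  bounded_measurable g -> (forall x, A x -> g x = 0) ->
  inner pi g (pker_op P g) <= l^-1 * inner pi g g.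
Proof.
move=> l1 tailK bg g0.
have l0 : 0 < l := lt_trans ltr01 l1.
have [mg [C gC]] := bg.
pose b k := inner pi (iter k Q g) (iter k Q g).
have bQ k : bounded_measurable (iter k Q g) by bmeas.
have Q0 k x : A x -> iter k Q g x = 0.
  by case: k => [|k] Ax; [exact: g0|exact: killed_op_in].
have QC k x : `|iter k Q g x| <= C * (K * l ^- k).
  rewrite (le_trans (iter_killed_op_le _ _ _ _ _ gC))// ler_wpM2l//.
  by rewrite (le_trans _ (gC x)).
have b_ratio : b 1 <= l^-1 ^+ 2 * b 0.
  apply: (@log_convex_first_ratio_le R b (l^-1 ^+ 2) ((C * K) ^+ 2)).
  - by rewrite exprn_gt0// invr_gt0.
  - by move=> k; exact: inner_ge0.
  - move=> k; have -> : b k.+1 = inner pi (iter k Q g) (iter k.+2 Q g).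
      exact: (inner_killed_op (bQ k) (bQ k.+1) (Q0 k) (Q0 k.+1)).
    exact: inner_cauchy_schwarz.
  - move=> k; rewrite (le_trans (ler_norm _))//.
    rewrite (le_trans (inner_norm_le pi (bQ k) (bQ k) (QC k) (QC k)))//.
    rewrite le_eqVlt; apply/orP; left; apply/eqP.
    by rewrite -exprM mulnC exprM exprVn; ring.
have -> : inner pi g (pker_op P g) = inner pi g (Q g).
  apply: eq_Rintegral => x _; have [Ax|Ax] := pselect (A x).
    by rewrite g0// !mul0r.
  by rewrite killed_op_notin.
have gg := inner_ge0 pi g.
rewrite (le_trans (ler_norm _))// -(@ler_pXn2r _ 2)//.
  all: rewrite ?nnegrE ?mulr_ge0 ?invr_ge0 ?(ltW l0)//.
rewrite real_normK ?num_real//; apply: le_trans (inner_cauchy_schwarz pi bg (bQ 1)) _.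
by rewrite exprMn [X in _ <= _ * X]expr2 mulrCA ler_wpM2l.
Qed.

End KilledNorm.

(** * Return to equilibrium from the atom and from other points *)

Section Atom.
Context d (X : measurableType d) (R : realType) (P : R.-pker X ~> X)
  (pi : probability X R) (A : set X)
  (hrev : reversible P pi) (hpos : nonneg_definite P pi)
  (hA : accessible_atom P pi A) (rho : R) (rho0 : 0 <= rho) (rho1 : rho <= 1)
  (killed_le : forall g, bounded_measurable g -> (forall x, A x -> g x = 0) ->
     inner pi g (pker_op P g) <= rho * inner pi g g).
Implicit Types f g h : X -> R.

Let mA : measurable A. Proof. by case: hA => -[]. Qed.

Definition constant_on (B : set X) f := exists c, forall x, B x -> f x = c.

Lemma pker_op_constant_on_atom f : bounded_measurable f ->
  constant_on A (pker_op P f).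
Proof.
move=> bf; case: hA => -[_ [nu hnu]] _; exists (\int[nu]_y f y) => x Ax.
rewrite /pker_op /Rintegral; congr fine; apply: eq_measure_integral => B mB _.
exact: hnu.
Qed.

(** The class on which P contracts by [rho]. P preserves it, since it keeps the integral and makes
    every function constant on the atom. *)
Definition centered f :=
  [/\ bounded_measurable f, \int[pi]_x f x = 0 & constant_on A f].

Lemma centered_pker_op f : centered f -> centered (pker_op P f).
Proof.
move=> [bf f0 _]; split; [bmeas|by rewrite Rint_pker_op|].
exact: pker_op_constant_on_atom.
Qed.

(* If [f] is centered and equal to [c] on [A], the form of [f - c], which
   vanishes on [A], exceeds that of [f] by [c ^ 2]. *)
Lemma centered_form_le f : centered f ->
  inner pi f (pker_op P f) <= rho * inner pi f f.
Proof.
move=> [bf f0 [c fc]].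
have b1 := @bounded_measurable_cst _ X R 1.
have bN := @bounded_measurable_cst _ X R (- c).
have bg : bounded_measurable (fun x => f x + - c * 1) by bmeas.
have g0 x : A x -> f x + - c * 1 = 0 by move=> /fc ->; rewrite mulr1 subrr.
have PgE : pker_op P (fun x => f x + - c * 1) =
    fun x => pker_op P f x + - c * 1.
  by apply/funext => x; rewrite pker_opD ?pker_op_cst//; bmeas.
have := killed_le bg g0.
rewrite PgE !innerDl ?innerDr ?innerZl ?innerZr//; try by bmeas.
rewrite ![inner pi f (fun=> 1)]innerC !inner1l Rint_pker_op// f0 Rint_cst => h.
(* [h] carries an extra c^2 on the left and rho c^2 on the right. *)
have : 0 <= (1 - rho) * c ^+ 2 by rewrite mulr_ge0 ?sqr_ge0// subr_ge0.
by nra.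
Qed.

(** With a = |f|^2 and b = |P f|^2 = <f, P (P f)>, Cauchy-Schwarz for the form gives b^2 <= (rho
    a)(rho b), as P f is centered too; then divide by b. *)
Lemma centered_norm_pker_op_le f : centered f ->
  inner pi (pker_op P f) (pker_op P f) <= rho ^+ 2 * inner pi f f.
Proof.
move=> cf; have cPf := centered_pker_op cf.
have [bf _ _] := cf; have [bPf _ _] := cPf.
set a := inner pi f f; set b := inner pi _ _.
have a0 : 0 <= a := inner_ge0 _ _; have : 0 <= b := inner_ge0 _ _.
rewrite le_eqVlt => /predU1P[<-|b0]; first by rewrite mulr_ge0 ?sqr_ge0.
rewrite -(ler_pM2r b0) -expr2.
have -> : b ^+ 2 = inner pi f (pker_op P (pker_op P f)) ^+ 2 by rewrite inner_pker_op.
apply: le_trans (pker_op_cauchy_schwarz hrev hpos bf bPf) _.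
have -> : rho ^+ 2 * a * b = (rho * a) * (rho * b) by ring.
by apply: ler_pM; rewrite ?inner_pker_op_ge0//; exact: centered_form_le.
Qed.

Lemma centered_norm_iter_le n f : centered f ->
  inner pi (iter n (pker_op P) f) (iter n (pker_op P) f) <= rho ^+ n.*2 * inner pi f f.
Proof.
move=> cf; have cn k : centered (iter k (pker_op P) f).
  by elim: k => //= k; exact: centered_pker_op.
elim: n => [|n IHn]; first by rewrite mul1r.
rewrite (le_trans (centered_norm_pker_op_le (cn n)))//.
have -> : rho ^+ n.+1.*2 = rho ^+ 2 * rho ^+ n.*2 by rewrite -exprD doubleS.
by rewrite -mulrA ler_wpM2l// sqr_ge0.
Qed.

Lemma atom_convergence n f x : bounded_measurable f -> (forall y, `|f y| <= 1) ->
  (0 < n)%N -> A x ->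
  `|iter n (pker_op P) f x - \int[pi]_y f y| <= C1 (fine (pi A)) * rho ^+ n.
Proof.
move=> bf f1 n0 Ax; set a := fine (pi A).
have a0 : 0 < a.
  case: hA => _ piA; rewrite fine_gt0// piA/=.
  by rewrite (le_lt_trans (probability_le1 _ _)) ?ltry.
have b1 := @bounded_measurable_cst _ X R 1.
have bA : bounded_measurable (\1_A : X -> R) by bmeas.
have ba := @bounded_measurable_cst _ X R a^-1.
have bN := @bounded_measurable_cst _ X R (-1).
have bPf := bounded_measurable_iter_pker_op P n bf.
pose u y : R := a^-1 * \1_A y + -1 * 1.
have bu : bounded_measurable u by rewrite /u; bmeas.
have intA : \int[pi]_y \1_A y = a by rewrite Rint_indic.
have cu : centered u.
  split => //; last first.
    by exists (a^-1 - 1) => y Ay; rewrite /u indicE mem_set// !mulr1.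
  rewrite RintD; [|bmeas..]; rewrite !RintZ// intA Rint_cst mulVf ?gt_eqF//.
  by rewrite mulr1 subrr.
(* This squared norm is the square of [C1]. *)
have uu : inner pi u u = a^-1 - 1.
  rewrite /u innerDl ?innerDr ?innerZl ?innerZr//; try by bmeas.
  rewrite ![inner pi (\1_A) (fun=> 1)]innerC !inner1l intA Rint_cst.
  have -> : inner pi \1_A \1_A = a.
    rewrite -intA; apply: eq_Rintegral => y _; rewrite indicE.
    by case: (_ \in _); rewrite ?mulr1 ?mulr0.
  by field; rewrite gt_eqF.
(* At least one step is required here, hence [0 < n]. *)
have constP : constant_on A (iter n (pker_op P) f).
  case: n n0 {bPf} => // n _; apply: pker_op_constant_on_atom.
  exact: bounded_measurable_iter_pker_op.
(* Moving P^n onto f, the pairing with [u] is the mean of P^n f over A, which is its value at x,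
   minus its integral. *)
have -> : iter n (pker_op P) f x - \int[pi]_y f y = inner pi (iter n (pker_op P) u) f.
  rewrite -inner_iter_pker_op// /u innerDl ?innerZl//; try by bmeas.
  rewrite inner1l Rint_iter_pker_op// mulN1r; congr (_ - _).
  have [c Pc] := constP; rewrite (Pc _ Ax).
  have -> : inner pi \1_A (iter n (pker_op P) f) = c * a.
    rewrite -intA -RintZ//; apply: eq_Rintegral => y _.
    have [/Pc ->|Ay] := pselect (A y); first by rewrite mulrC.
    by rewrite indicE memNset// mul0r mulr0.
  by rewrite mulrCA mulVf ?gt_eqF// mulr1.
have bPu := bounded_measurable_iter_pker_op P n bu.
have C1_ge0 : 0 <= C1 a := sqrtr_ge0 _.
rewrite -(@ler_pXn2r _ 2)// ?nnegrE ?mulr_ge0 ?exprn_ge0//.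
rewrite real_normK ?num_real//; apply: le_trans (inner_cauchy_schwarz pi bPu bf) _.
apply: (@le_trans _ _ (rho ^+ n.*2 * inner pi u u * 1)).
  apply: ler_pM; rewrite ?inner_ge0//; first exact: centered_norm_iter_le.
  rewrite (le_trans (ler_norm _))// -[leRHS]mulr1.
  exact: inner_norm_le.
rewrite mulr1 exprMn sqr_sqrtr; last by rewrite -uu inner_ge0.
by rewrite uu mulrC -exprM muln2.
Qed.

(* E_x [rho ^ (n - sigma_A)^+] *)
Fixpoint first_entrance n : X -> R :=
  if n is m.+1 then fun x => rho * first_entrance m x + (1 - rho) * hit_tail P A n x
  else fun=> 1.

Lemma bounded_measurable_first_entrance n : bounded_measurable (first_entrance n).
Proof.
elim: n => [|n IHn]; first exact: bounded_measurable_cst.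
have bt := bounded_measurable_hit_tail P mA n.+1.
apply: bounded_measurableD; exact: bounded_measurableZ.
Qed.

Lemma first_entrance_in n x : A x -> first_entrance n x = rho ^+ n.
Proof.
by move=> Ax; elim: n => //= n ->; rewrite /hit_tail/= killed_op_in// mulr0 addr0 exprS.
Qed.

(** First-step analysis: off A, one step lowers sigma_A by one, so n + 1 - sigma_A becomes n -
    sigma_A. *)
Lemma first_entrance_notin n x : ~ A x ->
  pker_op P (first_entrance n) x = first_entrance n.+1 x.
Proof.
move=> Ax; elim: n => [|n IHn] /=.
  by rewrite /hit_tail/= killed_op_notin// pker_op_cst; ring.
have bt := bounded_measurable_hit_tail P mA n.+1.
have be := bounded_measurable_first_entrance n.
rewrite pker_opD ?pker_opZ//; try exact: bounded_measurableZ.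
rewrite IHn; congr (_ + _ * _).
exact/esym/(killed_op_notin P (hit_tail P A n.+1) Ax).
Qed.

(** After sigma_A the atom bound applies for the remaining time. On sigma_A >= n only the trivial
    bound 2 is left; the first term already supplies C1 there and (2 - C1)^+ makes up the rest. Off
    A both sides are transported by P. *)
Lemma pointwise_convergence n f x : bounded_measurable f ->
  (forall y, `|f y| <= 1) ->
  `|iter n (pker_op P) f x - \int[pi]_y f y| <=
  C1 (fine (pi A)) * first_entrance n x
  + Num.max (2 - C1 (fine (pi A))) 0 * hit_tail P A n x.
Proof.
move=> bf f1; set C := C1 _; set m := Num.max _ _.
have C0 : 0 <= C := sqrtr_ge0 _.
have m0 : 0 <= m by rewrite le_max lexx orbT.
elim: n x => [|n IHn] x.
  rewrite /hit_tail /= !mulr1; apply: (@le_trans _ _ 2).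
    rewrite (le_trans (ler_normB _ _))// -[leRHS]/(1 + 1) lerD//.
    exact: Rint_norm_le.
  by rewrite -lerBlDl le_max lexx.
have [Ax|Ax] := pselect (A x).
  rewrite first_entrance_in// /hit_tail /= killed_op_in// mulr0 addr0.
  exact: (@atom_convergence n.+1).
have bt := bounded_measurable_hit_tail P mA n.
have be := bounded_measurable_first_entrance n.
have bPf := bounded_measurable_iter_pker_op P n bf.
have bi := @bounded_measurable_cst _ X R (\int[pi]_y f y).
have bd := bounded_measurableB bPf bi.
have bCe := bounded_measurableZ C be; have bmt := bounded_measurableZ m bt.
have -> : C * first_entrance n.+1 x + m * hit_tail P A n.+1 x =
    pker_op P (fun y => C * first_entrance n y + m * hit_tail P A n y) x.
  by rewrite pker_opD// !pker_opZ// first_entrance_notin// {1}/hit_tail /= killed_op_notin.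
have -> : iter n.+1 (pker_op P) f x - \int[pi]_y f y =
    pker_op P (fun y => iter n (pker_op P) f y - \int[pi]_z f z) x.
  by rewrite pker_opB// pker_op_cst.
apply: le_trans (pker_op_norm_op P x bd) _; apply: le_pker_op => //.
- have [md [D dD]] := bd; split; first exact: measurableT_comp.
  by exists D => y; rewrite normr_id.
- exact: bounded_measurableD.
Qed.

(** The bound solves x_(n+1) = rho x_n + (1 - rho) K l^(-n-1), x_0 = 1, exactly. *)
Lemma first_entrance_le (l K : R) n x : 1 < l -> l * rho < 1 ->
  (forall n x, hit_tail P A n x <= K * l ^- n) ->
  first_entrance n x <=
  rho ^+ n + (1 - rho) / (1 - l * rho) * K * (l ^- n - rho ^+ n).
Proof.
move=> l1 lrho tailK; elim: n => [|n IHn] /=.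
  by rewrite !expr0 invr1 subrr mulr0 addr0.
have r1 : 0 <= 1 - rho by rewrite subr_ge0.
apply: le_trans (lerD (ler_wpM2l rho0 IHn) (ler_wpM2l r1 (tailK n.+1 x))) _.
rewrite le_eqVlt; apply/orP; left; apply/eqP.
rewrite !exprS invfM; field.
by rewrite expf_neq0 ?gt_eqF ?subr_gt0// (lt_trans ltr01 l1).
Qed.

End Atom.

(** * Assembly of the convergence bound *)

Lemma onem_inv_le_ln (R : realType) (l : R) : 0 < l -> 1 - l^-1 <= ln l.
Proof.
move=> l0; have := @le_ln1Dx R (l^-1 - 1).
rewrite ltrBrDl subrr invr_gt0 subrKC lnV ?posrE// => /(_ l0); lra.
Qed.

(* The upper bound e^{1/M} on lambda is taken in [\bar R], where 0^-1 = +oo, so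
   that M = 0 is not excluded.  In that case A is the whole space, so C1 = 0 and
   the terms containing 1 / M or e^{1/M}, all multiplied by C1, vanish. *)
Theorem theorem3p1 (R : realType) (d d' : measure_display)
    (X : measurableType d) (W : measurableType d')
    (P : R.-pker X ~> X) (Px : X -> probability W R)
    (Phi : nat -> {mfun W >-> X}) (pi : probability X R) (A : set X) (M : R)
    (hX : countably_generated X)
    (hPhi : markov_chain P Px Phi)
    (hpi : unique_invariant_prob P pi)
    (hirr : pi_irreducible Px Phi pi)
    (hac : forall (n : nat) (x : X), (0 < n)%N -> nstep Px Phi n x `<< pi)
    (hrev : reversible P pi)
    (hpos : nonneg_definite P pi)
    (hA : accessible_atom P pi A)
    (hM : ereal_sup (range (fun x : X => (\int[Px x]_w hitting_time R Phi A w)%E))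
          = M%:E)
    (lambda : R) (hlambda1 : 1 < lambda)
    (hlambdaM : (lambda%:E < expeR (M%:E)^-1)%E) (n : nat) :
  (nstep_dist Px Phi pi n <=
    (D1 M lambda (fine (pi A)) * expR (- (n%:R / M))
     + E1 M lambda (fine (pi A)) * lambda ^- n)%:E)%E.
Proof.
have mA : measurable A by case: hA => -[].
apply: ge_ereal_sup => _ [x _ <-]; apply: ge_ereal_sup => _ [f [mf f1] <-].
have bf : bounded_measurable f by split => //; exists 1.
rewrite (nstep_expectation hPhi)// EFin_Rint// -EFinB abse_EFin lee_fin.
have SM N y : \sum_(k < N) hit_tail P A k.+1 y <= M.
  exact: (sum_killed_op_le hPhi N y mA hM).
have M_ge0 : 0 <= M by have := SM 0 x; rewrite big_ord0.
have l0 : 0 < lambda := lt_trans ltr01 hlambda1.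
have lnl_gt0 : 0 <= ln lambda by rewrite ln_ge0// ltW.
have Mln : M * ln lambda < 1.
  move: M_ge0; rewrite le_eqVlt => /predU1P[<-|M_gt0]; first by rewrite mul0r.
  move: hlambdaM; rewrite inver gt_eqF//= lte_fin => lM.
  by rewrite mulrC -ltr_pdivlMr// div1r -(expRK M^-1) ltr_ln ?posrE ?expR_gt0.
(* Passes from the Lyapunov constant to the one with ln lambda in [M1]. *)
have onem_le : M * (1 - lambda^-1) <= M * ln lambda.
  by rewrite ler_wpM2l// onem_inv_le_ln.
pose K := (1 - M * ln lambda)^-1.
have K0 : 0 < K by rewrite invr_gt0 subr_gt0.
have tailK m y : hit_tail P A m y <= K * lambda ^- m.
  apply: le_trans (hit_tail_geometric mA hlambda1 (le_lt_trans onem_le Mln) SM m y) _.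
  rewrite ler_wpM2r ?invr_ge0 ?exprn_ge0 ?(ltW l0)//.
  by rewrite lef_pV2 ?posrE ?subr_gt0 ?(le_lt_trans onem_le)// lerB.
have M1E : M1 M lambda = lambda * K by [].
set C := C1 (fine (pi A)); set m := Num.max (2 - C) 0.
have C0 : 0 <= C := sqrtr_ge0 _.
have m0 : 0 <= m by rewrite le_max lexx orbT.
have mtail : m * hit_tail P A n x <= m * (K * lambda ^- n) by rewrite ler_wpM2l.
move: M_ge0; rewrite le_eqVlt => /predU1P[M0|M_gt0].
  have AT : A = setT.
    apply/seteqP; split => // y _; apply: contrapT => Ay.
    have := SM 1%N y; rewrite big_ord_recr big_ord0/= add0r /hit_tail /=.
    by rewrite killed_op_notin// pker_op_cst -M0 ler10.
  have C_eq0 : C = 0.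
    by rewrite /C /C1 AT probability_setT/= invr1 subrr sqrtr0.
  (* The term with rho has the factor C = 0, so rho = 1 / lambda serves as well as any admissible
     rate. *)
  have linv0 : 0 <= lambda^-1 by rewrite invr_ge0 ltW.
  have linv1 : lambda^-1 <= 1 by rewrite invf_le1// ltW.
  apply: le_trans (pointwise_convergence hrev hpos hA linv0 linv1
    (fun g => killed_form_le mA hrev hlambda1 tailK) n x bf f1) _.
  rewrite -/C -/m (le_trans (lerD (lexx _) mtail))//.
  rewrite /D1 /E1 -/C -/m M1E C_eq0 !mul0r mulr0 addr0 !add0r.
  by rewrite le_eqVlt; apply/orP; left; apply/eqP; field; rewrite expf_neq0 gt_eqF.
have MV0 : 0 < M^-1 by rewrite invr_gt0.
pose e := expR M^-1; have e1 : 1 < e by rewrite expR_gt1.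
have e0 : 0 < e := expR_gt0 _.
(* At the rate e the constant 1 - M ln e vanishes, so [tailK] has no analogue; the sharper 1 - M (1
   - 1 / e) stays positive. *)
have Me : M * (1 - e^-1) < 1.
  rewrite mulrC -ltr_pdivlMr// div1r /e -expRN.
  by have := @expR_gt1Dx R (- M^-1); rewrite oppr_eq0 gt_eqF// => /(_ isT); lra.
have le : lambda < e by move: hlambdaM; rewrite inver gt_eqF//= lte_fin.
have eV0 : 0 <= e^-1 by rewrite invr_ge0 ltW.
have eV1 : e^-1 <= 1 by rewrite invf_le1// ltW.
have leV : lambda * e^-1 < 1 by rewrite ltr_pdivrMr// mul1r.
apply: le_trans (pointwise_convergence hrev hpos hA eV0 eV1
  (fun g => killed_form_le mA hrev e1 (hit_tail_geometric mA e1 Me SM)) n x bf f1) _.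
rewrite -/C -/m.
have fe := first_entrance_le eV0 eV1 n x hlambda1 leV tailK.
apply: le_trans (lerD (ler_wpM2l C0 fe) mtail) _.
have -> : expR (- (n%:R / M)) = e^-1 ^+ n.
  by rewrite -mulrN expRM_natl expRN.
rewrite /D1 /E1 -/C -/m M1E div1r -/e.
set r := (e - 1) / (e - lambda).
have -> : (1 - e^-1) / (1 - lambda / e) = r.
  by rewrite /r; field; rewrite !gt_eqF ?subr_gt0.
have r0 : 0 <= r by rewrite divr_ge0// subr_ge0 ltW.
have pow_le : e^-1 ^+ n <= lambda ^- n.
  by rewrite exprVn lef_pV2 ?posrE ?exprn_gt0// lerXn2r ?nnegrE ?(ltW e0) ?(ltW l0) ?(ltW le).
(* The argument yields K where [D1] and the second term of [E1] have M1 = lambda K; the stated bound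
   exceeds the obtained one by exactly this product. *)
have gap : 0 <= C * r * K * (lambda ^- n - e^-1 ^+ n) * (lambda - 1).
  apply: mulr_ge0; last by rewrite subr_ge0 ltW.
  apply: mulr_ge0; last by rewrite subr_ge0.
  by apply: mulr_ge0; [exact: mulr_ge0|exact: ltW].
have -> : lambda * K * (m * lambda^-1 + r * C) * lambda ^- n =
    m * (K * lambda ^- n) + lambda * K * r * C * lambda ^- n.
  by field; rewrite expf_neq0 gt_eqF.
by move: gap; set p := lambda ^- n; lra.
Qed.
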